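(* Let $(X,d_X)$ be a nonempty metric space, $(Y,d_Y)$ a metric space, and $f:X\to Y$ a continuous function. Then $f$ is uniformly continuous on $X$ if and only if there exists a family $\{g_\epsilon\}_{\epsilon>0}$ of delta-epsilon functions for $f$ such that $$\eta_\epsilon:=\inf_{x\in X} g_\epsilon(x)>0$$ for every $\epsilon>0$.
   Context: For $\epsilon>0$, a positive number $\delta$ is a delta-epsilon number for $f$ at $x\in X$ if for all $z\in X$, $d_X(z,x)<\delta$ implies $d_Y(f(z),f(x))<\epsilon$. For fixed $\epsilon>0$, a function $g_\epsilon:X\to\mathbb{R}^+$ (positive reals) is a delta-epsilon function for $f$ if for every $x\in X$, $g_\epsilon(x)$ is a delta-epsilon number for $f$ at $x$ (with respect to this $\epsilon$). A family $\{g_\epsilon\}_{\epsilon>0}$ of delta-epsilon functions consists of one delta-epsilon function $g_\epsilon$, with respect to $\epsilon$, for each $\epsilon>0$. *)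

(* Defs.v *)
From mathcomp Require Import all_boot all_order all_algebra.
From mathcomp Require Import all_classical all_reals all_analysis.

Set Implicit Arguments.
Unset Strict Implicit.
Unset Printing Implicit Defensive.

Import Order.TTheory GRing.Theory Num.Theory.

Local Open Scope classical_set_scope.
Local Open Scope ring_scope.

Definition delta_epsilon_number (R : realType) (X Y : metricType R)
    (f : X -> Y) (eps : R) (x : X) (delta : R) : Prop :=
  0 < delta /\ forall z : X, mdist z x < delta -> mdist (f z) (f x) < eps.

Definition delta_epsilon_function (R : realType) (X Y : metricType R)
    (f : X -> Y) (eps : R) (g : X -> {posnum R}) : Prop :=
  forall x : X, delta_epsilon_number f eps x (g x)%:num.

Definition delta_epsilon_family (R : realType) (X Y : metricType R)
    (f : X -> Y) (g : {posnum R} -> X -> {posnum R}) : Prop :=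
  forall eps : {posnum R}, delta_epsilon_function f eps%:num (g eps).

(* Main.v *)
Require Import Defs.
From mathcomp Require Import all_boot all_order all_algebra.
From mathcomp Require Import all_classical all_reals all_analysis.

Import Order.TTheory GRing.Theory Num.Theory.

Local Open Scope classical_set_scope.
Local Open Scope ring_scope.

(** Uniform continuity says that for each [eps] one [delta] serves at every
    point ([unif_continuous_mdistP]).  Such a [delta] gives a constant
    delta-epsilon function, whose infimum over the nonempty space is [delta]
    itself; choosing one for each [eps] yields the family.  Conversely, a
    positive number at most a delta-epsilon number is again one.  The infimum
    of [g eps] is at most [g eps x] for all [x], so if it is positive it is a
    [delta] that serves at every point. *)

(** The entourage definition of uniform continuity in terms of distances. *)
Lemma unif_continuous_mdistP (R : realType) (X Y : metricType R) (f : X -> Y) :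
  unif_continuous f <->
  forall eps : {posnum R}, exists delta : {posnum R},
    forall x z : X, mdist z x < delta%:num -> mdist (f z) (f x) < eps%:num.
Proof.
rewrite unif_continuousP; split=> [fu eps|fu _/posnumP[eps]].
  have [_/posnumP[delta] fdelta] := fu eps%:num (gt0 eps).
  exists delta => x z zx.
  by have := fdelta (z, x); rewrite /= !ballEmdist; apply.
have [delta fdelta] := fu eps.
exists delta%:num => // -[z x] /=.
by rewrite !ballEmdist; apply: fdelta.
Qed.

Theorem theorem4 (R : realType) (X Y : metricType R)
    (X_nonempty : [set: X] !=set0) (f : X -> Y) (f_cont : continuous f) :
  unif_continuous f <->
  exists g : {posnum R} -> X -> {posnum R},
    delta_epsilon_family f g /\
    forall eps : {posnum R}, 0 < inf [set (g eps x)%:num | x in [set: X]].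
Proof.
rewrite unif_continuous_mdistP; split=> [/choice[delta fdelta]|[g [fg inf_gt0]]].
  exists (fun eps _ => delta eps); split=> [eps x|eps].
    by split=> // z; apply: fdelta.
  apply: (@lt_le_trans _ _ (delta eps)%:num) => //.
  apply: lb_le_inf; first exact: image_nonempty.
  by move=> _ [x _ <-].
move=> eps; exists (PosNum (inf_gt0 eps)) => x z zx.
apply: (fg eps x).2; apply: lt_le_trans zx _.
apply: ge_inf; last by exists x.
by exists 0 => _ [y _ <-].
Qed.
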